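(* For all $n\ge 1$, $$(-1)^{n-1}\mu_{P_n}(t)=N_n(t),$$ where $P_n$ is the path graph on $[n]$ and $N_n(t)=\sum_{j=0}^{n-1}\frac1n\binom nj\binom n{j+1}t^j$ is the Narayana polynomial. Consequently $(-1)^{n-1}\mu_{P_n}(1)=C_n$, where $C_n=\frac1{n+1}\binom{2n}n$ is the Catalan number.
   Context: $[n]=\{1,\dots,n\}$, and $P_n$ is the graph on $[n]$ with edge set $\{\{i,i+1\}: i\in[n-1]\}$. A weighted partition of a finite set $S$ is a set $\boldsymbol{\pi}=\{B_1^{v_1},\dots,B_k^{v_k}\}$ where $\{B_1,\dots,B_k\}$ is a partition of $S$ (the underlying partition of $\boldsymbol\pi$) and each weight $v_i\in\{0,1,\dots,|B_i|-1\}$. The poset $\mathcal W\Pi_S$ consists of all weighted partitions of $S$, with $\{A_1^{w_1},\dots,A_j^{w_j}\}\le\{B_1^{v_1},\dots,B_k^{v_k}\}$ iff $\{A_1,\dots,A_j\}$ refines $\{B_1,\dots,B_k\}$ and, whenever $B_m=A_{i_1}\cup\dots\cup A_{i_l}$, one has $v_m-(w_{i_1}+\dots+w_{i_l})\in\{0,1,\dots,l-1\}$. For a graph $G=(V,E)$, the weighted bond poset $\mathcal W\Pi_G$ is the induced subposet of $\mathcal W\Pi_V$ consisting of weighted partitions each of whose blocks induces a connected subgraph of $G$. Its minimum element $\hat 0$ has all blocks singletons of weight $0$. For connected $G$, the maximal elements are $\{V^j\}$, $0\le j\le |V|-1$, and the Möbius polynomial of $G$ is $\mu_G(t)=\sum_{j=0}^{|V|-1}\mu_{\mathcal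 W\Pi_G}(\hat 0,\{V^j\})\,t^j$, where $\mu_P$ is the Möbius function of a poset $P$. *)

(* Defs.v *)
From HB Require Import structures.
From mathcomp Require Import all_boot all_order all_algebra.
From mathcomp Require Import zify.

Set Implicit Arguments.
Unset Strict Implicit.
Unset Printing Implicit Defensive.

Import Order.TTheory GRing.Theory Num.Theory.

Local Open Scope ring_scope.

(* Möbius function of a finite poset. The first argument of [mobius_rec] bounds
   the recursion depth; [mobius_refl], [mobius_lt] and [mobius_notle] are the
   usual defining equations, free of that bound. *)

Section Mobius.

Variables (d : Order.disp_t) (T : finPOrderType d).
Implicit Types x y z : T.

Fixpoint mobius_rec (k : nat) x y : int :=
  if k is k'.+1 then
    if x == y then 1
    else - \sum_(z | (x <= z)%O && (z < y)%O) mobius_rec k' x z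
  else 0.

Definition mobius x y : int := mobius_rec #|T| x y.

Let below x y := #|[set z | (x <= z)%O && (z < y)%O]|.

Lemma mobius_rec_stable k l x y :
  (below x y < k)%N -> (below x y < l)%N ->
  mobius_rec k x y = mobius_rec l x y.
Proof.
elim: k l y => [|k IHk] [|l] y //= lk ll.
case: eqP => // _; congr (- _); apply: eq_bigr => z /andP[xz zy].
have lt_below: (below x z < below x y)%N.
  apply/proper_card/properP; split.
    by apply/subsetP => u; rewrite !inE => /andP[-> /lt_trans ->].
  by exists z; rewrite !inE xz ?ltxx ?zy.
by apply: IHk; [exact: leq_trans lt_below _ | exact: leq_trans lt_below _].
Qed.

Lemma below_lt_card x y : (below x y < #|T|)%N.
Proof.
rewrite -cardsT; apply/proper_card/properP; split; first exact/subsetP.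
by exists y; rewrite !inE ?ltxx ?andbF.
Qed.

Lemma mobiusE x y :
  mobius x y =
    if x == y then 1 else - \sum_(z | (x <= z)%O && (z < y)%O) mobius x z.
Proof.
rewrite {1}/mobius (@mobius_rec_stable _ #|T|.+1) /= ?ltnS ?below_lt_card //.
by rewrite ltnW // below_lt_card.
Qed.

Lemma mobius_refl x : mobius x x = 1.
Proof. by rewrite mobiusE eqxx. Qed.

Lemma mobius_lt x y : (x < y)%O ->
  mobius x y = - \sum_(z | (x <= z)%O && (z < y)%O) mobius x z.
Proof. by move=> /lt_eqF xy; rewrite mobiusE xy. Qed.

Lemma mobius_notle x y : ~~ (x <= y)%O -> mobius x y = 0.
Proof.
move=> xy; rewrite mobiusE; case: eqP => [exy|_]; first by rewrite exy lexx in xy.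
rewrite big_pred0 ?oppr0 // => z; apply/negP => /andP[xz /ltW zy].
by rewrite (le_trans xz zy) in xy.
Qed.

End Mobius.

Section WeightedPartitions.

Variable V : finType.

(* The pair (B, v) stands for B^v. The bound on v only serves to obtain a finite
   type; [is_wpart] imposes the actual constraint v < #|B|. *)
Definition wblock : finType := ({set V} * 'I_#|V|.+1)%type.

Definition underlying (pi : {set wblock}) : {set {set V}} :=
  [set B.1 | B in pi].

Definition is_wpart (pi : {set wblock}) : bool :=
  [&& partition (underlying pi) [set: V],
      dinjectiveb (fun B : wblock => B.1) [in pi]
    & [forall B in pi, (B.2 < #|B.1|)%N]].

Record wpart : Type := WPart { wpart_val :> {set wblock}; _ : is_wpart wpart_val }.

HB.instance Definition _ := [isSub for wpart_val].
HB.instance Definition _ := [Finite of wpart by <:].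

Definition subblocks (pi : {set wblock}) (C : {set V}) : {set wblock} :=
  [set A in pi | A.1 \subset C].

(* With s the total weight and l the number of the blocks of pi contained in
   B.1, the condition s <= v < s + l says v - s \in {0, ..., l - 1}. *)
Definition wpart_le (pi rho : wpart) : bool :=
  [forall A in wpart_val pi, exists B in wpart_val rho, A.1 \subset B.1] &&
  [forall B in wpart_val rho,
     let s := (\sum_(A in subblocks pi B.1) A.2)%N in
     (s <= B.2 < s + #|subblocks pi B.1|)%N].

Implicit Types (pi rho sigma : wpart) (A B C : wblock).

Lemma wpart_neq0 pi A : A \in wpart_val pi -> exists x, x \in A.1.
Proof.
case/and3P: (valP pi) => /and3P[_ _ pi0] _ _ Api; apply/set0Pn.
by apply: contraNneq pi0 => <-; apply: imset_f.
Qed.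

Lemma wpart_meet pi A B x :
  A \in wpart_val pi -> B \in wpart_val pi -> x \in A.1 -> x \in B.1 -> A = B.
Proof.
case/and3P: (valP pi) => /and3P[_ /trivIsetP tI _] /dinjectiveP inj _.
move=> Api Bpi xA xB; apply: inj => //; apply/eqP/negPn/negP => neqAB.
have := tI _ _ (imset_f _ Api) (imset_f _ Bpi) neqAB.
by move/pred0P/(_ x); rewrite /= xA xB.
Qed.

Lemma wpart_sub pi A B :
  A \in wpart_val pi -> B \in wpart_val pi -> A.1 \subset B.1 -> A = B.
Proof.
by move=> Api Bpi /subsetP sAB; have [x xA] := wpart_neq0 Api;
  apply: (wpart_meet Api Bpi xA); apply: sAB.
Qed.

Lemma wpart_cover pi x : exists2 A, A \in wpart_val pi & x \in A.1.
Proof.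
case/and3P: (valP pi) => /and3P[/eqP cov _ _] _ _.
have: x \in cover (underlying (\val pi)) by rewrite cov inE.
by case/bigcupP => _ /imsetP[A Api ->] xA; exists A.
Qed.

Lemma subblocks_self pi B : B \in wpart_val pi -> subblocks pi B.1 = [set B].
Proof.
move=> Bpi; apply/setP => A; rewrite !inE; apply/andP/eqP => [[Api sAB]|->].
  exact: wpart_sub Api Bpi sAB.
by rewrite subxx.
Qed.

Lemma wpart_leP pi rho :
  reflect ((forall A, A \in wpart_val pi ->
              exists2 B, B \in wpart_val rho & A.1 \subset B.1) /\
           (forall B, B \in wpart_val rho ->
              let s := (\sum_(A in subblocks pi B.1) A.2)%N in
              (s <= B.2 < s + #|subblocks pi B.1|)%N))
          (wpart_le pi rho).
Proof.
apply: (iffP andP) => -[ref wt]; split.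
- by move=> A /(forall_inP ref)/exists_inP.
- by move=> B /(forall_inP wt).
- by apply/forall_inP => A /ref ?; apply/exists_inP.
- by apply/forall_inP => B /wt.
Qed.

Lemma wpart_le_refl : reflexive wpart_le.
Proof.
move=> pi; apply/wpart_leP; split=> [A Api|B Bpi]; first by exists A.
by rewrite /= subblocks_self // big_set1 cards1 addn1 leqnn ltnSn.
Qed.

Lemma wpart_le_anti : antisymmetric wpart_le.
Proof.
suff sub pi rho : wpart_le pi rho -> wpart_le rho pi ->
    wpart_val pi \subset wpart_val rho.
  by move=> pi rho /andP[pr rp]; apply/val_inj/eqP; rewrite eqEsubset !sub.
move=> /wpart_leP[pr wt] /wpart_leP[rp _]; apply/subsetP => A Api.
have [B Brho sAB] := pr A Api; have [A' A'pi sBA'] := rp B Brho.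
have eAA' := wpart_sub Api A'pi (subset_trans sAB sBA').
have eAB: A.1 = B.1 by apply/eqP; rewrite eqEsubset sAB eAA' sBA'.
have := wt B Brho; rewrite -eAB subblocks_self //= big_set1 cards1 addn1 ltnS.
rewrite -eqn_leq => /eqP e2.
suff -> : A = B by [].
by apply/eqP; rewrite -pair_eqE /= eAB eqxx; apply/eqP/val_inj.
Qed.

Lemma wpart_le_trans : transitive wpart_le.
Proof.
move=> rho pi sigma /wpart_leP[pr wpr] /wpart_leP[rs wrs]; apply/wpart_leP.
split=> [A /pr[B /rs[C Cs sBC] sAB]|C Cs].
  by exists C => //; apply: subset_trans sBC.
have regroup (F : wblock -> nat) : (\sum_(A in subblocks pi C.1) F A =
    \sum_(B in subblocks rho C.1) \sum_(A in subblocks pi B.1) F A)%N.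
  rewrite (exchange_big_dep [in subblocks pi C.1]) /=.
    apply: eq_bigr => A; rewrite inE => /andP[Api sAC].
    have [B Br sAB] := pr A Api; rewrite (big_pred1 B) // => B' /=.
    rewrite !inE Api /=; apply/idP/eqP => [/andP[/andP[B'r _] sAB']|->].
      have [x xA] := wpart_neq0 Api.
      exact: (wpart_meet B'r Br (subsetP sAB' x xA) (subsetP sAB x xA)).
    rewrite Br sAB andbT /=; have [C' C's sBC'] := rs B Br.
    have [x xA] := wpart_neq0 Api.
    rewrite (wpart_meet Cs C's (subsetP sAC x xA)) //.
    by apply/(subsetP sBC')/(subsetP sAB).
  move=> B A; rewrite !inE => /andP[_ sBC] /andP[-> sAB].
  exact: subset_trans sBC.
have := wrs C Cs => /=; have := regroup (fun A => A.2 : nat).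
have := regroup (fun=> 1%N); rewrite sum1_card => -> ->.
have lo : (\sum_(B in subblocks rho C.1) \sum_(A in subblocks pi B.1) A.2
           <= \sum_(B in subblocks rho C.1) B.2)%N.
  by apply: leq_sum => B; rewrite inE => /andP[/wpr/andP[]].
have hi : (\sum_(B in subblocks rho C.1) B.2 + #|subblocks rho C.1| <=
   \sum_(B in subblocks rho C.1) \sum_(A in subblocks pi B.1) A.2 +
   \sum_(B in subblocks rho C.1) \sum_(A in subblocks pi B.1) 1)%N.
  rewrite -sum1_card -!big_split /=; apply: leq_sum => B.
  by rewrite inE sum1_card addn1 => /andP[/wpr/andP[]].
move=> /andP[h1 h2]; rewrite (leq_trans lo h1) /=.
by apply: leq_trans h2 hi.
Qed.

End WeightedPartitions.

Fact wpart_display : Order.disp_t. Proof. exact: Order.Disp tt tt. Qed.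

HB.instance Definition _ (V : finType) :=
  Order.Le_isPOrder.Build wpart_display (wpart V)
    (@wpart_le_refl V) (@wpart_le_anti V) (@wpart_le_trans V).

Record sgraph (V : finType) : Type := SGraph {
  edge :> rel V;
  edge_sym : symmetric edge;
  edge_irr : irreflexive edge }.

Section WeightedBonds.

Variables (V : finType) (G : sgraph V).

Definition induces_connected (B : {set V}) : bool :=
  [forall x in B, forall y in B,
     connect [rel u v | [&& u \in B, v \in B & G u v]] x y].

Definition connected_graph : bool := induces_connected [set: V].

Definition is_wbond (pi : wpart V) : bool :=
  [forall B in wpart_val pi, induces_connected B.1].

Record wbond : Type := WBond { wbond_val :> wpart V; _ : is_wbond wbond_val }.

HB.instance Definition _ := [isSub for wbond_val].
HB.instance Definition _ := [Finite of wbond by <:].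
HB.instance Definition _ := [SubChoice_isSubPOrder of wbond by <: with wpart_display].

Definition wbond_bot_set : {set wblock V} := [set ([set x], ord0) | x : V].

Lemma is_wpart_bot : is_wpart wbond_bot_set.
Proof.
apply/and3P; split.
- apply/and3P; split.
  + rewrite /cover eqEsubset subsetT; apply/subsetP => x _; apply/bigcupP.
    exists [set x]; last exact: set11.
    have xbot : ([set x], ord0) \in wbond_bot_set by exact: imset_f.
    exact: (imset_f (fun B : wblock V => B.1) xbot).
  + apply/trivIsetP => B C /imsetP[B' /imsetP[x _ ->] ->].
    move=> /imsetP[C' /imsetP[y _ ->] ->] /= neq.
    by rewrite disjoints1 inE; apply: contraNneq neq => ->.
  + apply/imsetP => -[B /imsetP[x _ ->]] /= /setP/(_ x).
    by rewrite !inE eqxx.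
- by apply/dinjectiveP => A B /imsetP[x _ ->] /imsetP[y _ ->] /= ->.
- by apply/forall_inP => _ /imsetP[x _ ->] /=; rewrite cards1.
Qed.

Lemma is_wbond_bot : is_wbond (WPart is_wpart_bot).
Proof.
apply/forall_inP => _ /imsetP[x _ ->] /=.
by apply/forall_inP => y /set1P->; apply/forall_inP => z /set1P->; exact: connect0.
Qed.

Definition wbond_bot : wbond := WBond is_wbond_bot.

Lemma wbond_bot_le (pi : wbond) : (wbond_bot <= pi)%O.
Proof.
apply/wpart_leP; split=> [_ /imsetP[x _ ->]|B Bpi /=].
  by have [B Bpi xB] := wpart_cover pi x; exists B; rewrite ?sub1set.
rewrite big1 /=; last by move=> A; rewrite inE => /andP[/imsetP[x _ ->]].
case/and3P: (valP (wbond_val pi)) => _ _ /forall_inP/(_ B Bpi).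
rewrite add0n => /leq_trans-> //.
rewrite -(@card_imset _ _ (fun x : V => ([set x], ord0) : wblock V)).
  apply/subset_leq_card/subsetP => _ /imsetP[x xB ->].
  by rewrite inE imset_f //= sub1set.
by move=> x y [/set1_inj].
Qed.

HB.instance Definition _ :=
  Order.hasBottom.Build _ wbond wbond_bot_le.

Definition wbond_top_set (j : 'I_#|V|) : {set wblock V} :=
  [set ([set: V], widen_ord (leqnSn #|V|) j)].

Lemma is_wpart_top (j : 'I_#|V|) : is_wpart (wbond_top_set j).
Proof.
apply/and3P; split.
- rewrite /underlying imset_set1 /=; apply/and3P; split.
  + by rewrite /cover big_set1.
  + by apply/trivIsetP => A B /set1P-> /set1P->; rewrite eqxx.
  + by rewrite inE eq_sym -card_gt0 cardsT (leq_trans _ (ltn_ord j)).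
- by apply/dinjectiveP => A B /set1P-> /set1P->.
- by apply/forall_inP => _ /set1P-> /=; rewrite cardsT.
Qed.

Lemma is_wbond_top (cG : connected_graph) (j : 'I_#|V|) :
  is_wbond (WPart (is_wpart_top j)).
Proof. by apply/forall_inP => _ /set1P->. Qed.

(* {V^j} is a maximal element, in general not a greatest one. *)
Definition wbond_top (cG : connected_graph) (j : 'I_#|V|) : wbond :=
  WBond (is_wbond_top cG j).

Definition mobius_poly (cG : connected_graph) : {poly int} :=
  \sum_(j < #|V|) mobius \bot%O (wbond_top cG j) *: 'X^j.

End WeightedBonds.

Section PathGraph.

Variable n : nat.

(* The vertex i + 1 of [n] = {1, ..., n} is represented by i : 'I_n. *)
Definition path_edge : rel 'I_n := [rel i j : 'I_n | (i.+1 == j) || (j.+1 == i)].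

Lemma path_edge_sym : symmetric path_edge.
Proof. by move=> i j; rewrite /path_edge /= orbC. Qed.

Lemma path_edge_irr : irreflexive path_edge.
Proof. by move=> i; rewrite /path_edge /= orbb eqn_leq ltnn. Qed.

Definition path_graph : sgraph 'I_n := SGraph path_edge_sym path_edge_irr.

Lemma path_graph_connected : connected_graph path_graph.
Proof.
set r := [rel u v | [&& u \in [set: 'I_n], v \in [set: 'I_n] & path_graph u v]].
have symr : connect_sym r.
  by apply: sym_connect_sym => i j; rewrite /= !inE path_edge_sym.
have up k (i j : 'I_n) : (i + k)%N = j -> connect r i j.
  elim: k j => [|k IHk] j ij.
    by rewrite (_ : i = j) //; apply/val_inj; rewrite /= -ij addn0.
  have lt_ik : (i + k < n)%N by have := ltn_ord j; lia.
  apply: connect_trans (IHk (Ordinal lt_ik) erefl) (connect1 _).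
  by rewrite /= !inE /path_edge /= -ij addnS eqxx.
apply/forall_inP => i _; apply/forall_inP => j _.
case: (leqP i j) => [ij|/ltnW ji]; first by apply: up (subnKC ij).
by rewrite [connect _ _ _]symr; apply: up (subnKC ji).
Qed.

End PathGraph.

Definition narayana_poly (n : nat) : {poly rat} :=
  \sum_(j < n) (n%:R^-1 * 'C(n, j)%:R * 'C(n, j.+1)%:R) *: 'X^j.

Definition catalan (n : nat) : rat := n.+1%:R^-1 * 'C(2 * n, n)%:R.

(* Main.v *)
Require Import Defs.
From mathcomp Require Import all_boot all_order all_algebra.
From mathcomp Require Import zify ring.

Set Implicit Arguments.
Unset Strict Implicit.
Unset Printing Implicit Defensive.

Import Order.TTheory GRing.Theory Num.Theory.

Local Open Scope ring_scope.

(** The interval below a weighted bond factors over its blocks, so the Möbius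
function is the product over the blocks of a weight depending only on size and
weight. In generating functions, with [F = \sum_n mu_{P_n}(t) x^n] and
[[k] = 1 + t + ... + t^(k-1)], the defining recursion reads
[\sum_k [k] F^k = x], i.e. [F = x (1 - F) (1 - t F)]. We guess
[[x^n] F^k = (-1)^(n+k) (k/n) \sum_j C(n,j) C(n,j+k) t^j] (Lagrange inversion),
and check it through the recurrence that
[F^(k+1) = x (F^k - (1 + t) F^(k+1) + t F^(k+2))] imposes, which also gives the
multiplicativity in [k] and the identity [\sum_k [k] F^k = x]. *)

(** * Powers of the Narayana series *)

(* The coefficient of x^n t^j in the k-th power of N = x (1 + N) (1 + t N). *)
Definition narpow_coef (n k j : nat) : rat :=
  if n is 0 then ((k == 0%N) && (j == 0%N))%:R
  else k%:R / n%:R * 'C(n, j)%:R * 'C(n, j + k)%:R.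

Definition narpow (n k : nat) : {poly rat} := \poly_(j < n.+1) narpow_coef n k j.

Lemma coef_narpow n k j : (narpow n k)`_j = narpow_coef n k j.
Proof.
rewrite coef_poly; case: ltnP => // lt_nj; case: n lt_nj => [|n] lt_nj /=.
  by rewrite (gtn_eqF lt_nj) andbF.
by rewrite bin_small // mulr0 mul0r.
Qed.

Lemma narpow0 k : narpow 0 k = (k == 0%N)%:R.
Proof.
by apply/polyP=> j; rewrite coef_narpow -polyC_natr coefC /=; case: eqP; case: eqP.
Qed.

Lemma narpowS0 n : narpow n.+1 0 = 0.
Proof. by apply/polyP=> j; rewrite coef_narpow coef0 /= !mul0r. Qed.

(** Compares coefficients in N^(k+1) = x (N^k + (1 + t) N^(k+1) + t N^(k+2)), which is the
    functional equation times N^k. The case [n = 0] is separate because the closed formula divides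
    by [n]. *)
Lemma narpow_coef_rec n k j :
  narpow_coef n.+1 k.+1 j.+1 =
  narpow_coef n k j.+1 + (narpow_coef n k.+1 j.+1 + narpow_coef n k.+1 j) +
  narpow_coef n k.+2 j.
Proof.
case: n => [|n] /=.
  by rewrite (@bin_small 1 (j.+1 + k.+1)) ?mulr0 ?andbF ?addr0 //; lia.
have natS i : i.+1%:R = i%:R + 1 :> rat by rewrite natr1.
have : (n.+1%:R : rat) != 0 by rewrite pnatr_eq0.
move: n.+1 => {n} m m0.
have pascal i : ('C(m.+1, i.+1)%:R : rat) = 'C(m, i.+1)%:R + 'C(m, i)%:R.
  by rewrite binS natrD.
have low i : (i.+1%:R * 'C(m.+1, i.+1)%:R : rat) = m.+1%:R * 'C(m, i)%:R.
  by rewrite -!natrM mul_bin_diag.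
rewrite (_ : (j.+1 + k.+1 = (j + k.+1).+1)%N); last lia.
rewrite (_ : (j.+1 + k = j + k.+1)%N); last lia.
rewrite (_ : (j + k.+2 = (j + k.+1).+1)%N); last lia.
have := pascal j; have := low j; have := pascal (j + k.+1)%N; have := low (j + k.+1)%N.
set s := 'C(m.+1, j.+1)%:R; set u := 'C(m.+1, _)%:R.
set a := 'C(m, j.+1)%:R; set a' := 'C(m, j)%:R.
set b := 'C(m, (j + k.+1).+1)%:R; set b' := 'C(m, _)%:R.
have m1 : (m.+1%:R : rat) != 0 by rewrite pnatr_eq0.
rewrite !natS !natrD !natS in m1 *.
move: (m%:R : rat) m0 m1 => M M0 M1 H1 H2 H3 H4.
(* Absorption and Pascal express all four binomials of row [m] through the two binomials [s] and [u]
   of row [m.+1]; what remains is an identity of rational functions. *)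
have e1 : a' = (j%:R + 1) * s / (M + 1) by rewrite H3; field.
have e2 : b' = (j%:R + (k%:R + 1) + 1) * u / (M + 1) by rewrite H1; field.
have -> : a = s - a' by rewrite H4; ring.
have -> : b = u - b' by rewrite H2; ring.
rewrite e1 e2; field.
by apply/andP.
Qed.

Lemma narpow_coef_rec0 n k :
  narpow_coef n.+1 k.+1 0 = narpow_coef n k 0 + narpow_coef n k.+1 0.
Proof.
case: n => [|n] /=.
  rewrite !add0n bin0 andbT; case: k => [|k] /=; first by [].
  by rewrite bin_small // mulr0.
have : (n.+1%:R : rat) != 0 by rewrite pnatr_eq0.
move: n.+1 => {n} m m0; rewrite !add0n !bin0 !mulr1.
have m1 : (m.+1%:R : rat) != 0 by rewrite pnatr_eq0.
have low : (k.+1%:R * 'C(m.+1, k.+1)%:R : rat) = m.+1%:R * 'C(m, k)%:R.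
  by rewrite -!natrM mul_bin_diag.
move: low; rewrite binS natrD; set a := 'C(m, k.+1)%:R; set b := 'C(m, k)%:R => low.
have k1 : (k.+1%:R : rat) != 0 by rewrite pnatr_eq0.
have -> : a = m.+1%:R * b / k.+1%:R - b by rewrite -low mulrC mulKf ?addrK.
rewrite -!natr1 in m1 k1 *; field.
by rewrite k1 m0 m1.
Qed.

Arguments narpow_coef : simpl never.

Lemma narpow_rec n k :
  narpow n.+1 k.+1 = narpow n k + (1 + 'X) * narpow n k.+1 + 'X * narpow n k.+2.
Proof.
apply/polyP=> -[|j]; rewrite mulrDl mul1r !(coefD, coefXM, coef_narpow) /=.
  by rewrite narpow_coef_rec0 !addr0.
exact: narpow_coef_rec.
Qed.

(* For k > 0 both sides satisfy [narpow_rec]; for k = 0 they agree since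
   [narpow n 0 = (n == 0)]. *)
Lemma narpow_conv n k :
  narpow n k.+1 = \sum_(i < n.+1) narpow i 1 * narpow (n - i) k.
Proof.
elim: n k => [|n IHn] k; first by rewrite big_ord1 !narpow0 mul0r.
case: k => [|k].
  rewrite big_ord_recr /= subnn narpow0 mulr1 big1 ?add0r // => i _.
  by rewrite subSn -1?ltnS // narpowS0 mulr0.
rewrite narpow_rec !{}IHn [RHS]big_ord_recr /= subnn narpow0 mulr0 addr0.
rewrite !mulr_sumr -!big_split /=; apply: eq_bigr => i _.
by rewrite subSn -1?ltnS // narpow_rec; ring.
Qed.

(** * Signed powers and the alternating sum *)

Definition qnat (k : nat) : {poly rat} := \sum_(i < k) 'X^i.

Lemma qnatS k : qnat k.+1 = qnat k + 'X^k.
Proof. by rewrite /qnat big_ord_recr. Qed.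

(** N has no constant term, so N^k is divisible by x^k. *)
Lemma narpow_small n k : (n < k)%N -> narpow n k = 0.
Proof.
move=> lt_nk; apply/polyP=> j; rewrite coef_narpow coef0.
rewrite /narpow_coef; case: n lt_nk => [|n] lt_nk; first by rewrite gtn_eqF.
by rewrite (@bin_small _ (j + k)) ?mulr0 //; lia.
Qed.

(** The coefficient of x^n in F^k: the substitution F(x) = -N(-x) turns N = x (1 + N) (1 + t N) into
    F = x (1 - F) (1 - t F). *)
Definition snarpow n k : {poly rat} := (-1) ^+ (n + k) * narpow n k.

Lemma snarpow_conv n k :
  snarpow n k.+1 = \sum_(i < n.+1) snarpow i 1 * snarpow (n - i) k.
Proof.
rewrite /snarpow narpow_conv mulr_sumr; apply: eq_bigr => i _.
rewrite mulrACA -exprD; congr (_ ^+ _ * _); have := ltn_ord i; lia.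
Qed.

(* By [narpow_rec] the coefficient of [narpow n' k] in the sum for n = n' + 1 is,
   up to sign, qnat (k + 1) - (1 + 'X) qnat k + 'X qnat (k - 1), which is 0
   unless k = 0. *)
Lemma snarpow_alt n m : (n < m)%N ->
  \sum_(k < m) qnat k * snarpow n k = (n == 1%N)%:R.
Proof.
case: m => // m; rewrite ltnS => le_nm.
rewrite big_ord_recl /= /qnat big_ord0 mul0r add0r -/qnat.
case: n le_nm => [_|n lt_nm].
  by rewrite big1 // => k _; rewrite /snarpow narpow0 !mulr0.
have step k : qnat (bump 0 k) * snarpow n.+1 (bump 0 k) =
    (-1) ^+ (n + k) * (qnat k.+1 * narpow n k) +
    (-1) ^+ (n + k) * ((1 + 'X) * (qnat k.+1 * narpow n k.+1)) +
    (-1) ^+ (n + k) * ('X * (qnat k.+1 * narpow n k.+2)).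
  by rewrite /bump /= add1n /snarpow narpow_rec addSn addnS !exprS; ring.
under eq_bigr do rewrite step.
rewrite !big_split /=.
set s1 := \sum_(i < m) _; set s2 := \sum_(i < m) _; set s3 := \sum_(i < m) _.
(* The three sums involve [narpow n] at k, k + 1 and k + 2. They are reindexed to a common
   [narpow n k] so as to add termwise; the bound [m.+2] leaves room for the largest shift, and the
   terms added at the top vanish since [n < m]. *)
pose h c := \sum_(k < m.+2) (-1) ^+ (n + k) * (c k * narpow n k) : {poly rat}.
have zero k : (m <= k)%N -> narpow n k = 0 by move=> ?; apply: narpow_small; lia.
have q0 : qnat 0 = 0 by rewrite /qnat big_ord0.
have -> : s1 = h (fun k => qnat k.+1).
  by rewrite /h !big_ord_recr /= !zero // !mulr0 !addr0.
have -> : s2 = h (fun k => - (1 + 'X) * qnat k).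
  rewrite /h big_ord_recr /= zero // !mulr0 addr0 big_ord_recl q0 mulr0 mul0r mulr0 add0r.
  by apply: eq_bigr => k _; rewrite /= /bump /= add1n addnS exprS; ring.
have -> : s3 = h (fun k => 'X * qnat k.-1).
  rewrite /h !big_ord_recl /= q0 !(mulr0, mul0r) !add0r.
  by apply: eq_bigr => k _; rewrite /= /bump /= !add1n !addnS !exprS; ring.
rewrite /h -!big_split /= big_ord_recl /= big1 => [|k _].
  rewrite addr0 addn0 qnatS q0 !(mulr0,mul0r) add0r expr0 mul1r !addr0.
  by case: (n) => [|n']; rewrite ?narpow0 ?narpowS0 ?mulr0 ?expr0 ?mulr1.
by rewrite /bump /= add1n /= !qnatS exprS; ring.
Qed.

(** Vanishing sums over principal ideals are the recursion of the Möbius function, so a guess [g]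
    can be verified without computing it. Induction on the number of elements strictly below [y]. *)
Lemma mobius_bot_unique d (T : finPOrderType d) (x0 : T) (g : T -> rat) :
  (forall x, (x0 <= x)%O) -> g x0 = 1 ->
  (forall y, y != x0 -> \sum_(z | (z <= y)%O) g z = 0) ->
  forall y, (mobius x0 y)%:~R = g y.
Proof.
move=> ge_x0 g0 gsum y.
have [k] := ubnP #|[set z | (z < y)%O]|; elim: k => // k IHk in y *.
rewrite ltnS => le_k; case: (eqVneq y x0) => [->|y_neq0].
  by rewrite mobius_refl g0.
have lt0y : (x0 < y)%O by rewrite lt_neqAle eq_sym y_neq0 ge_x0.
have := gsum _ y_neq0; rewrite (bigD1 y) //= => /eqP; rewrite addr_eq0 => /eqP ->.
rewrite mobius_lt // rmorphN /= rmorph_sum /=; congr (- _); apply: eq_big => z.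
  by rewrite ge_x0 /= lt_neqAle andbC.
move=> /andP[_ lt_zy]; apply: IHk; apply: leq_trans le_k.
apply/proper_card/properP; split.
  by apply/subsetP => u; rewrite !inE => /lt_trans->.
by exists z; rewrite !inE ?ltxx ?lt_zy.
Qed.

(** * Factorization of principal ideals over blocks, for any graph *)

Section Bonds.

Variables (V : finType) (G : sgraph V).
Implicit Types (z : {set wblock V}) (A B : wblock V) (C : {set V}).

Definition bond_block A :=
  [&& A.1 != set0, induces_connected G A.1 & (A.2 < #|A.1|)%N].

(** Bond partitions are taken as bare sets of weighted blocks, since the ground set [C] shrinks
    during recursion while a [wbond] always covers all of [V]. *)
Definition bonds_on C z :=
  [forall A in z, bond_block A && (A.1 \subset C)] &&
  [forall x in C, #|[set A in z | x \in A.1]| == 1%N].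

Lemma bonds_onP C z :
  reflect [/\ forall A, A \in z -> bond_block A /\ A.1 \subset C,
              forall x, x \in C -> exists2 A, A \in z & x \in A.1
            & forall A B x, A \in z -> B \in z -> x \in A.1 -> x \in B.1 -> A = B]
          (bonds_on C z).
Proof.
apply: (iffP andP) => [[/forall_inP blk /forall_inP one]|[blk cov uniq]].
  have blkP A : A \in z -> bond_block A /\ A.1 \subset C by move=> /blk/andP.
  split=> // [x /one/cards1P[A eA]|A B x Az Bz xA xB].
    by have := set11 A; rewrite -eA inE => /andP[]; exists A.
  have [_ sAC] := blkP A Az.
  have /one/cards1P[D eD] := subsetP sAC x xA.
  have: A \in [set D] by rewrite -eD inE Az.
  have: B \in [set D] by rewrite -eD inE Bz.
  by move=> /set1P-> /set1P->.
split; first by apply/forall_inP => A /blk[-> ->].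
apply/forall_inP => x /cov[A Az xA]; apply/cards1P; exists A.
apply/setP=> B; rewrite !inE; apply/andP/eqP => [[Bz xB]|-> //].
exact: uniq Bz Az xB xA.
Qed.

Lemma bond_block_neq0 A : bond_block A -> exists x, x \in A.1.
Proof. by case/and3P => /set0Pn. Qed.

Lemma wbond_bonds_on (pi : wbond G) : bonds_on [set: V] (wpart_val pi).
Proof.
apply/bonds_onP; split.
- move=> A Api; rewrite subsetT; split=> //; apply/and3P; split.
  + by apply/set0Pn/(wpart_neq0 Api).
  + by have /forall_inP := valP pi; apply.
  + by case/and3P: (valP (wbond_val pi)) => _ _ /forall_inP; apply.
- by move=> x _; apply: wpart_cover.
- by move=> A B x; apply: wpart_meet.
Qed.

Lemma bonds_on_wpart z : bonds_on [set: V] z -> is_wpart z.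
Proof.
case/bonds_onP => blk cov uniq; apply/and3P; split.
- apply/and3P; split.
  + rewrite eqEsubset subsetT; apply/subsetP => x /cov[A Az xA].
    by apply/bigcupP; exists A.1 => //; apply: imset_f.
  + apply/trivIsetP => _ _ /imsetP[A Az ->] /imsetP[B Bz ->] neqAB.
    rewrite -setI_eq0; apply/set0Pn => -[x /setIP[xA xB]].
    by rewrite (uniq A B x) ?eqxx in neqAB.
  + apply/imsetP => -[A Az e0]; have [/bond_block_neq0[x]] := blk A Az.
    by rewrite -e0 inE.
- apply/dinjectiveP => A B Az Bz eAB; have [/bond_block_neq0[x xA] _] := blk A Az.
  by apply: (uniq A B x) => //; rewrite -eAB.
- by apply/forall_inP => A /blk[/and3P[]].
Qed.

Lemma bonds_on_wbond z (zP : bonds_on [set: V] z) :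
  is_wbond G (WPart (bonds_on_wpart zP)).
Proof.
by apply/forall_inP => A Az; case/bonds_onP: (zP) => /(_ A Az)[/and3P[]].
Qed.

Lemma big_wbond (P : pred {set wblock V}) (F : {set wblock V} -> rat) :
  \sum_(pi : wbond G | P (wpart_val pi)) F (wpart_val pi) =
  \sum_(z | bonds_on [set: V] z && P z) F z.
Proof.
symmetry.
pose mk z : option (wbond G) := obind insub (insub z : option (wpart V)).
rewrite (reindex_omap (fun pi : wbond G => wpart_val pi) mk) /=.
  apply: eq_bigl => pi; rewrite wbond_bonds_on /=.
  by rewrite /mk valK /= valK eqxx andbT.
move=> z /andP[zP _]; rewrite /mk insubT /=; first exact: bonds_on_wpart.
by move=> zw; rewrite insubT //; case/bonds_onP: (zP) => blk _ _;
  apply/forall_inP => A /blk[/and3P[]].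
Qed.

(** Exactly one block contains [x], and removing it leaves a bond partition of the rest of [C]. *)
Lemma bonds_on_peel C x (R : pzSemiRingType) (F : {set wblock V} -> R) : x \in C ->
  \sum_(z | bonds_on C z) F z =
  \sum_(A | [&& bond_block A, x \in A.1 & A.1 \subset C])
     \sum_(z | bonds_on (C :\: A.1) z) F (A |: z).
Proof.
move=> xC.
(* The inner sum has a single term, the block of [x]; it is there to make the sums exchangeable. *)
transitivity (\sum_(z | bonds_on C z) \sum_(A in z | x \in A.1) F z).
  apply: eq_bigr => z /bonds_onP[_ /(_ x xC)[A Az xA] uniq].
  rewrite (big_pred1 A) // => B /=; apply/andP/eqP => [[Bz xB]|->//].
  exact: uniq Bz Az xB xA.
rewrite (exchange_big_dep (fun A => [&& bond_block A, x \in A.1 & A.1 \subset C])) /=; last first.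
  by move=> z A /bonds_onP[blk _ _] /andP[/blk[-> ->] ->].
apply: eq_bigr => A /and3P[blkA xA sAC].
rewrite (reindex_onto (fun z => A |: z) (fun z => z :\ A)) /=; last first.
  by move=> z /and3P[_ Az _]; rewrite setD1K.
apply: eq_bigl => z; rewrite setU11 xA /= andbT.
apply/andP/bonds_onP => [[/bonds_onP[blk cov uniq] /eqP e]|[blk cov uniq]].
  have Anz : A \notin z by rewrite -e !inE eqxx.
  have sz : {subset z <= A |: z} by move=> B; apply: setU1r.
  split.
  - move=> B Bz; have [blkB sBC] := blk B (sz _ Bz); split=> //.
    apply/subsetP => y yB; rewrite inE (subsetP sBC) // andbT.
    apply: contraNN Anz => yA.
    by have <- : B = A by apply: (uniq B A y); rewrite ?setU11 ?sz.
  - move=> y /setDP[/cov[B /setU1P[->|Bz] yB] yA]; last by exists B.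
    by rewrite yB in yA.
  - by move=> B D y /sz Bz /sz Dz; apply: uniq.
have Anz : A \notin z.
  apply/negP => /blk[_ /subsetP/(_ x xA)]; by rewrite inE xA.
have out B y : B \in z -> y \in B.1 -> y \notin A.1.
  by move=> /blk[_ /subsetP sB] /sB /setDP[].
split; last by rewrite setU1K.
apply/bonds_onP; split.
- move=> B /setU1P[->//|/blk[blkB sB]]; split=> //.
  by apply: subset_trans sB (subsetDl _ _).
- move=> y yC; case: (boolP (y \in A.1)) => yA; first by exists A; rewrite ?setU11.
  have [|B Bz yB] := cov y; first by rewrite inE yA.
  by exists B; rewrite ?setU1r.
- move=> B D y /setU1P[->|Bz] /setU1P[->|Dz] yB yD //.
  + by have := out D y Dz yD; rewrite yB.
  + by have := out B y Bz yB; rewrite yD.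
  + exact: uniq yB yD.
Qed.

Lemma bonds_on_set0 z : bonds_on set0 z = (z == set0).
Proof.
apply/bonds_onP/eqP => [[blk _ _]|->].
  apply/setP => A; rewrite inE; apply/negP => /blk[/bond_block_neq0[x xA]].
  by move=> /subsetP/(_ x xA); rewrite inE.
by split=> [A|x|A B x]; rewrite inE.
Qed.

Definition total_weight z : nat := \sum_(A in z) A.2.

Definition weight_ok z v := (total_weight z <= v < total_weight z + #|z|)%N.

(** Refining [pi], weights aside, means choosing a bond partition of each block independently. Since
    the blocks of [pi] are disjoint, two members of [z] that share a vertex lie in the same
    block. *)
Lemma wbond_le_decomp (pi : wbond G) z :
  (bonds_on [set: V] z && [forall A in z, exists B in wpart_val pi, A.1 \subset B.1]) =
  (z == \bigcup_(B in wpart_val pi) subblocks z B.1) &&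
  [forall B in wpart_val pi, bonds_on B.1 (subblocks z B.1)].
Proof.
have /bonds_onP[blkp covp uniqp] := wbond_bonds_on pi.
have subP B : subblocks z B.1 \subset z by apply/subsetP=> A; rewrite inE => /andP[].
apply/andP/andP => -[]; last first.
  move=> /eqP e /forall_inP zB.
  have mem A : A \in z -> exists2 B, B \in wpart_val pi & A \in subblocks z B.1.
    by rewrite {1}e => /bigcupP[B]; exists B.
  split; last first.
    apply/forall_inP => A /mem[B Bpi]; rewrite inE => /andP[_ sAB].
    by apply/exists_inP; exists B.
  apply/bonds_onP; split.
  - move=> A /mem[B /zB/bonds_onP[blk _ _]] /blk[-> _]; by rewrite subsetT.
  - move=> x /covp[B Bpi xB]; have /bonds_onP[_ /(_ x xB)[A + xA] _] := zB B Bpi.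
    by rewrite inE => /andP[Az _]; exists A.
  - move=> A D x Az Dz xA xD.
    have [B Bpi AzB] := mem A Az; have [E Epi DzE] := mem D Dz.
    have eBE : B = E.
      apply: (uniqp B E x) => //.
      + by move: AzB; rewrite inE => /andP[_ /subsetP]; apply.
      + by move: DzE; rewrite inE => /andP[_ /subsetP]; apply.
    rewrite -eBE in DzE; have /bonds_onP[_ _ uniq] := zB B Bpi.
    exact: uniq AzB DzE xA xD.
move=> /bonds_onP[blk cov uniq] /forall_inP ref; split.
  apply/eqP/setP => A; apply/idP/bigcupP => [Az|[B _]].
    by have /exists_inP[B Bpi sAB] := ref A Az; exists B; rewrite ?inE ?Az.
  by rewrite inE => /andP[].
apply/forall_inP => B Bpi; apply/bonds_onP; split.
- by move=> A; rewrite inE => /andP[/blk[]].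
- move=> x xB; have [|A Az xA] := cov x; first by rewrite inE.
  exists A => //; rewrite inE Az /=; have /exists_inP[E Epi sAE] := ref A Az.
  by rewrite (uniqp B E x) //; apply: (subsetP sAE).
- move=> A D x; rewrite !inE => /andP[Az _] /andP[Dz _]; exact: uniq.
Qed.

(** Both refinement and the weight condition are local to the blocks of [pi]. Expanding the product
    on the right gives a sum over choice functions [f], which correspond to the refinements of [pi]
    through [cut] and [glue]. *)
Lemma sum_le_wbond (pi : wbond G) (g : wblock V -> rat) :
  \sum_(rho : wbond G | (rho <= pi)%O) \prod_(A in wpart_val rho) g A =
  \prod_(B in wpart_val pi)
    \sum_(z | bonds_on B.1 z && weight_ok z B.2) \prod_(A in z) g A.
Proof.
set y := wpart_val pi.
have /bonds_onP[blkp covp uniqp] := wbond_bonds_on pi.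
pose le z := [forall A in z, exists B in y, A.1 \subset B.1] &&
             [forall B in y, weight_ok (subblocks z B.1) B.2].
rewrite (eq_bigl (fun rho : wbond G => le (wpart_val rho))) //.
rewrite (big_wbond le (fun z => \prod_(A in z) g A)).
(* Choice functions are defined on all weighted blocks; off [pi] the value is forced to be [set0],
   with factor 1. *)
pose Q B z := if B \in y then bonds_on B.1 z && weight_ok z B.2 else z == set0.
transitivity (\prod_B \sum_(z | Q B z) if B \in y then \prod_(A in z) g A else 1);
  last first.
  rewrite [RHS]big_mkcond /=; apply: eq_bigr => B _; rewrite /Q.
  by case: (B \in y) => //; rewrite big_pred1_eq.
rewrite bigA_distr_big_dep /=.
pose cut z := [ffun B => if B \in y then subblocks z B.1 else set0].
pose glue (f : {ffun wblock V -> {set wblock V}}) := \bigcup_(B in y) f B.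
have dec z : bonds_on [set: V] z && le z =
    (z == glue (cut z)) && [forall B in y, Q B (subblocks z B.1)].
  rewrite /le andbA wbond_le_decomp -/y -andbA; congr (_ && _).
    congr (_ == _); apply: eq_bigr => B By; by rewrite ffunE By.
  rewrite /Q; apply/andP/forall_inP => [[/forall_inP h1 /forall_inP h2] B By|h].
    by rewrite By h1 ?h2.
  by split; apply/forall_inP => B By; have:= h B By; rewrite By => /andP[].
have cutK f B : f \in family Q -> B \in y -> subblocks (glue f) B.1 = f B.
  move=> /familyP fQ By; apply/setP => A; rewrite inE.
  have QE E : E \in y -> bonds_on E.1 (f E).
    by move=> Ey; have: Q E (f E) := fQ E; rewrite /Q Ey => /andP[].
  apply/andP/idP => [[/bigcupP[E Ey AfE] sAB]|AfB].
    have /bonds_onP[/(_ A AfE)[/bond_block_neq0[x xA] sAE] _ _] := QE E Ey.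
    by rewrite (uniqp B E x) // ?(subsetP sAB) ?(subsetP sAE).
  split; first by apply/bigcupP; exists B.
  by have /bonds_onP[/(_ A AfB)[]] := QE B By.
rewrite (reindex_onto glue cut) /=; last first.
  by move=> z; rewrite dec => /andP[/eqP <-].
apply: eq_big => [f|f].
  rewrite dec; apply/andP/idP => [[/andP[_ /forall_inP h] /eqP <-]|fQ].
    apply/familyP => B; rewrite -[_ \in _]/(Q B _) ffunE; case: ifP => By; first exact: h.
    by rewrite /Q By.
  have ec : cut (glue f) = f.
    apply/ffunP => B; rewrite ffunE; case: ifP => By; first exact: cutK.
    by move/familyP: fQ => fQ; have: Q B (f B) := fQ B; rewrite /Q By => /eqP.
  rewrite ec !eqxx; split=> //=; apply/forall_inP => B By.
  by rewrite cutK //; move/familyP: fQ; apply.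
rewrite dec => /andP[/andP[_ /forall_inP hQ] /eqP ec].
rewrite -big_mkcond /=.
have fE B : B \in y -> f B = subblocks (glue f) B.1.
  by move=> By; rewrite -{1}ec ffunE By.
under [RHS]eq_bigr => B By do rewrite (fE B By).
(* Each [A] in [glue f] lies below only one block of [pi], so the double product collapses. *)
rewrite (exchange_big_dep [in glue f]) /=; last first.
  by move=> B A _; rewrite inE => /andP[].
apply: eq_bigr => A Af.
have /bigcupP[B By AfB] := Af.
rewrite (big_pred1 B) // => E /=; rewrite inE Af /=.
have := hQ B By; rewrite /Q By => /andP[/bonds_onP[blkB _ _] _].
have [] := blkB A; first by rewrite -fE.
move=> /bond_block_neq0[x xA] sAB.
apply/andP/eqP => [[Ey sAE]|->]; last by [].
by apply: (uniqp E B x); rewrite // ?(subsetP sAE) ?(subsetP sAB).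
Qed.

End Bonds.

(** * Bonds of the path and their Möbius function *)

Section Path.

Variable n : nat.
Notation G := (path_graph n).
Implicit Types (z : {set wblock 'I_n}) (A : wblock 'I_n) (B : {set 'I_n}).

Definition seg (a b : nat) : {set 'I_n} := [set i : 'I_n | (a <= i < b)%N].

Lemma card_seg a b : (b <= n)%N -> #|seg a b| = (b - a)%N.
Proof.
elim: b => [|b IHb] lt_bn.
  by apply/eqP; rewrite sub0n cards_eq0; apply/eqP/setP=> i; rewrite !inE; lia.
case: (leqP a b) => [le_ab|lt_ba]; last first.
  rewrite (_ : seg a b.+1 = set0) ?cards0; first lia.
  by apply/setP=> i; rewrite !inE; lia.
rewrite (_ : seg a b.+1 = Ordinal lt_bn |: seg a b).
  by rewrite cardsU1 IHb ?inE /=; lia.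
by apply/setP=> i; rewrite !inE -val_eqE /=; lia.
Qed.

Lemma induces_connected_seg a b : induces_connected G (seg a b).
Proof.
set r := [rel u v | [&& u \in seg a b, v \in seg a b & G u v]].
have symr : connect_sym r.
  by apply: sym_connect_sym => i j; rewrite /= path_edge_sym andbCA.
have up k (i j : 'I_n) : i \in seg a b -> j \in seg a b -> (i + k)%N = j ->
    connect r i j.
  elim: k j => [|k IHk] j iB jB ij.
    by rewrite (_ : i = j) //; apply/val_inj; rewrite /= -ij addn0.
  have lt_ik : (i + k < n)%N by have := ltn_ord j; lia.
  have kB : Ordinal lt_ik \in seg a b by move: iB jB; rewrite !inE /=; lia.
  apply: connect_trans (IHk (Ordinal lt_ik) iB kB erefl) (connect1 _).
  by rewrite /= kB jB /path_edge /= -ij addnS eqxx.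
apply/forall_inP => i iB; apply/forall_inP => j jB.
case: (leqP i j) => [ij|/ltnW ji]; first by apply: up (subnKC ij).
by rewrite [connect _ _ _]symr; apply: up (subnKC ji).
Qed.

(** A walk from [x] to [y] inside [B] moves by one at each step, so it cannot jump over [w]. *)
Lemma induces_connected_convex B (x y w : 'I_n) :
  induces_connected G B -> x \in B -> y \in B -> (x <= w <= y)%N -> w \in B.
Proof.
move=> /forall_inP/(_ x _)/[swap] xB /(_ xB)/forall_inP/(_ y _)/[swap] yB /(_ yB).
move=> /connectP[p]; elim: p x xB => [|u p IHp] x xB /=.
  by move=> _ -> le_xwx; rewrite (_ : w = x) //; apply/val_inj => /=; lia.
case/andP=> /and3P[_ uB exu] pth ey /andP[le_xw le_wy].
case: (leqP u w) => [le_uw|lt_wu]; first by apply: (IHp u) => //; rewrite le_uw.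
suff -> : w = x by [].
apply/val_inj => /=; move: exu; rewrite /path_edge /= => /orP[] /eqP; lia.
Qed.

Lemma induces_connectedE (a : 'I_n) B : induces_connected G B -> a \in B ->
  (forall x, x \in B -> (a <= x)%N) -> B = seg a (a + #|B|).
Proof.
move=> cB aB minB.
have [m mB maxB] : exists2 m, m \in B & forall x, x \in B -> (x <= m)%N.
  by case: (arg_maxnP (fun i : 'I_n => i : nat) aB) => m mB maxB; exists m.
have eB : B = seg a m.+1.
  apply/setP=> x; rewrite inE ltnS; apply/idP/idP => [xB|].
    by rewrite minB ?maxB.
  exact: induces_connected_convex cB aB mB.
have := card_seg a (ltn_ord m); rewrite -eB => ->.
by rewrite subnKC //; have := minB _ mB; lia.
Qed.

(** The claimed factor of a block of size m and weight v: the coefficient of x^m t^v in F. *)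
Definition nweight A : rat := (snarpow #|A.1| 1)`_A.2.

Lemma coef_snarpow m k j : (snarpow m k)`_j = (-1) ^+ (m + k) * narpow_coef m k j.
Proof. by rewrite /snarpow -polyC1 -polyCN -rmorphXn coefCM coef_narpow. Qed.


Lemma coef_snarpow_small m j : (m <= j)%N -> (snarpow m 1)`_j = 0.
Proof.
move=> le_mj; rewrite coef_snarpow /narpow_coef.
case: m le_mj => [|m] le_mj; first by rewrite mulr0.
by rewrite (@bin_small _ (j + 1)) ?mulr0 //; lia.
Qed.

(** The admissible weights of a block of size [m] exhaust the support of the polynomial. *)
Lemma sum_weights m : (m <= n)%N ->
  \sum_(v : 'I_#|'I_n|.+1 | (v < m)%N) (snarpow m 1)`_v *: 'X^v = snarpow m 1.
Proof.
move=> le_mn; rewrite big_mkcond /=.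
transitivity (\poly_(v < #|'I_n|.+1) (snarpow m 1)`_v).
  rewrite poly_def; apply: eq_bigr => v _; case: ltnP => // le_mv.
  by rewrite coef_snarpow_small // scale0r.
apply/polyP=> j; rewrite coef_poly; case: ltnP => //; rewrite card_ord => lt_nj.
by rewrite coef_snarpow_small //; lia.
Qed.

(** A connected block containing the left end of a segment is an initial segment, determined by its
    length [i]; summing over its weights yields [snarpow i 1]. The term [i = 0] is harmless, as F
    has no constant term. *)
Lemma sum_first_blocks a b (F : nat -> {poly rat}) (b_le : (b <= n)%N)
    (x : 'I_n) : x = a :> nat ->
  \sum_(A | [&& bond_block G A, x \in A.1 & A.1 \subset seg a b])
     nweight A *: 'X^(A.2) * F #|A.1| =
  \sum_(i < (b - a).+1) snarpow i 1 * F i.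
Proof.
move=> xa; pose P B := [&& induces_connected G B, x \in B & B \subset seg a b].
rewrite (eq_bigl (fun A => P A.1 && (A.2 < #|A.1|)%N)); last first.
  move=> A; rewrite /bond_block /P; case: (boolP (x \in A.1)) => xA; last by rewrite !andbF.
  have -> : A.1 != set0 by apply/set0Pn; exists x.
  by rewrite /= -!andbA; congr (_ && _); rewrite andbC.
rewrite -(pair_big_dep P (fun B (v : 'I_#|'I_n|.+1) => (v < #|B|)%N)
   (fun B v => (snarpow #|B| 1)`_v *: 'X^v * F #|B|)) /=.
rewrite (eq_bigr (fun B => snarpow #|B| 1 * F #|B|)); last first.
  move=> B _; rewrite -mulr_suml sum_weights //.
  by rewrite -[X in (_ <= X)%N](card_ord n); apply: max_card.
have s0 : snarpow 0 1 = 0 by rewrite /snarpow narpow0 mulr0.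
rewrite [RHS]big_ord_recl /= s0 mul0r add0r.
have lenb (i : 'I_(b - a)) : (a + bump 0 i <= n)%N.
  by rewrite /bump /=; have := ltn_ord i; lia.
pose h (i : 'I_(b - a)) := seg a (a + bump 0 i).
have cardh i : #|h i| = bump 0 i by rewrite card_seg // addKn.
pose h' B : option 'I_(b - a) := insub #|B|.-1.
rewrite (reindex_omap h h') /=; last first.
  move=> B /and3P[cB xB sB].
  have eB : B = seg a (a + #|B|).
    rewrite -xa; apply: induces_connectedE => // y /(subsetP sB).
    by rewrite inE xa => /andP[].
  have B0 : (0 < #|B|)%N by rewrite card_gt0; apply/set0Pn; exists x.
  have le_B : (#|B| <= b - a)%N by rewrite -(card_seg a b_le) subset_leq_card.
  rewrite /h' insubT /=; first by rewrite prednK.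
  by move=> lt_B; rewrite /h /bump /= add1n prednK // -eB.
apply: eq_big => [i|i _]; last by rewrite cardh.
rewrite /P induces_connected_seg /= /h' cardh valK eqxx andbT.
apply/andP; split; first by rewrite inE xa /bump /=; lia.
by apply/subsetP => y; rewrite !inE /bump /=; have := ltn_ord i; lia.
Qed.

(** Induction on the number of blocks: removing the block of the left end leaves a shorter segment,
    and the sum over its length is the convolution [snarpow_conv]. *)
Lemma sum_bonds_on_seg a b k : (a <= b <= n)%N ->
  \sum_(z | bonds_on G (seg a b) z && (#|z| == k))
     \prod_(A in z) (nweight A *: 'X^(A.2)) = snarpow (b - a) k.
Proof.
elim: k a => [|k IHk] a /andP[le_ab le_bn].
  case: (ltngtP a b) le_ab => // [lt_ab _|-> _].
    rewrite /snarpow (_ : (b - a = (b - a.+1).+1)%N) ?narpowS0 ?mulr0; last lia.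
    rewrite big_pred0 // => z; apply/andP => -[/bonds_onP[_ cov _]].
    rewrite cards_eq0 => /eqP z0; have [|A] := cov (Ordinal (leq_trans lt_ab le_bn)).
      by rewrite inE /= leqnn.
    by rewrite z0 inE.
  have -> : seg b b = set0 by apply/setP=> i; rewrite !inE; lia.
  rewrite subnn /snarpow narpow0 expr0 mulr1 (big_pred1 set0) ?big_set0 // => z.
  by rewrite /= bonds_on_set0; case: eqP => // ->; rewrite cards0.
case: (ltngtP a b) le_ab => // [lt_ab _|-> _]; last first.
  have -> : seg b b = set0 by apply/setP=> i; rewrite !inE; lia.
  rewrite subnn /snarpow narpow0 mulr0 big_pred0 // => z.
  by rewrite bonds_on_set0; case: eqP => // ->; rewrite cards0.
pose x := Ordinal (leq_trans lt_ab le_bn).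
have xS : x \in seg a b by rewrite inE /= leqnn.
rewrite big_mkcondr /= (bonds_on_peel G _ xS) snarpow_conv.
rewrite -(sum_first_blocks (fun i => snarpow (b - a - i) k) le_bn (erefl : x = a :> nat)).
apply: eq_bigr => A /and3P[/and3P[A0 cA vA] xA sA].
have eA : A.1 = seg a (a + #|A.1|).
  apply: (induces_connectedE (a := x)) => // y /(subsetP sA).
  by rewrite inE => /andP[].
have le_A : (#|A.1| <= b - a)%N by rewrite -(card_seg a le_bn) subset_leq_card.
have -> : seg a b :\: A.1 = seg (a + #|A.1|) b.
  by apply/setP=> y; rewrite {1}eA !inE; lia.
rewrite -subnDA -IHk; last by rewrite le_bn andbT; lia.
rewrite mulr_sumr [RHS]big_mkcondr /=; apply: eq_bigr => z /bonds_onP[blk _ _].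
have Anz : A \notin z.
  apply/negP => /blk[_ /subsetP/(_ x xA)]; rewrite inE /= -[X in (_ <= X < _)%N]addn0.
  by rewrite leq_add2l leqn0 cards_eq0 (negPf A0).
by rewrite cardsU1 Anz add1n eqSS big_setU1.
Qed.

Lemma coef_qnatXn k w v : (qnat k * 'X^w)`_v = (w <= v < w + k)%N%:R.
Proof.
rewrite coefMXn; case: ltnP => //= le_wv; rewrite /qnat coef_sum.
under eq_bigr do rewrite coefXn.
case: ltnP => h; last first.
  by rewrite big1 // => i _; case: eqP => //; have := ltn_ord i; lia.
have lt : (v - w < k)%N by lia.
rewrite (bigD1 (Ordinal lt)) //= eqxx big1 ?addr0 // => i.
by rewrite -val_eqE /= eq_sym => /negPf ->.
Qed.

(* [qnat k * 'X^w] collects the admissible weights w, ..., w + k - 1 of a block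
   split into k parts of total weight w, so the sum is a coefficient of the
   polynomial of [snarpow_alt]. *)
Lemma sum_bonds_on_weight_ok a b v : (a <= b <= n)%N ->
  \sum_(z | bonds_on G (seg a b) z && weight_ok z v) \prod_(A in z) nweight A =
  (((b - a == 1)%N && (v == 0%N))%:R : rat).
Proof.
(* Large enough to bound both the number of blocks of any [z] and, as [snarpow_alt] requires, the
   length of the segment. *)
move=> le_abn; pose m := (#|wblock 'I_n| + n).+1.
have lt_m : (b - a < m)%N by rewrite /m; lia.
transitivity ((\sum_(k < m) qnat k * snarpow (b - a) k)`_v); last first.
  by rewrite snarpow_alt // -polyC_natr coefC; case: (_ == 1)%N; case: (v == _).
have wgt z : \prod_(A in z) (nweight A *: 'X^(A.2)) =
    (\prod_(A in z) nweight A) *: 'X^(total_weight z) :> {poly rat}.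
  by rewrite scaler_prod /total_weight -expr_sum.
rewrite coef_sum big_mkcondr /=.
have lt_z z : (#|z| < m)%N by rewrite /m ltnS; apply: leq_trans (max_card _) (leq_addr _ _).
rewrite (partition_big (fun z => Ordinal (lt_z z)) xpredT) //=.
apply: eq_bigr => k _; rewrite -(sum_bonds_on_seg k le_abn) mulr_sumr coef_sum.
apply: eq_big => [z|z /andP[_ /eqP <-]]; first by rewrite -val_eqE.
rewrite wgt -scalerAr coefZ coef_qnatXn /weight_ok.
by case: ifP; rewrite ?mulr1 ?mulr0.
Qed.

Lemma bond_block_seg (A : wblock 'I_n) : bond_block G A ->
  exists a b, [/\ (a < b <= n)%N, A.1 = seg a b & (b - a = #|A.1|)%N].
Proof.
case/and3P => /set0Pn[x xA] cA _.
have [a aA minA] : exists2 a, a \in A.1 & forall y, y \in A.1 -> (a <= y)%N.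
  by case: (arg_minnP (fun i : 'I_n => i : nat) xA) => a aA minA; exists a.
have eA := induces_connectedE cA aA minA.
have A0 : (0 < #|A.1|)%N by rewrite card_gt0; apply/set0Pn; exists x.
(* The minimum makes [b <= n] immediate and does not change the segment, whose members are all below
   [n]. *)
exists a, (minn n (a + #|A.1|)).
have eA' : A.1 = seg a (minn n (a + #|A.1|)).
  by rewrite {1}eA; apply/setP=> i; rewrite !inE; have := ltn_ord i; lia.
have := ltn_ord a; split=> //; first by lia.
by rewrite [in RHS]eA' card_seg //; lia.
Qed.

(** The sum of the product over the ideal below [pi] factors over blocks, and the factor of any
    block with at least two vertices is 0. *)
Lemma mobius_path (pi : wbond G) :
  (mobius \bot%O pi)%:~R = \prod_(A in wpart_val pi) nweight A :> rat.
Proof.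
pose g (rho : wbond G) := \prod_(A in wpart_val rho) nweight A.
apply: (mobius_bot_unique (g := g)) => [rho||{}pi pi_neq0].
- exact: le0x.
- rewrite /g big1 // => _ /imsetP[x _ ->].
  by rewrite /nweight cards1 coef_snarpow.
rewrite sum_le_wbond.
have /bonds_onP[blk cov uniq] := wbond_bonds_on pi.
(* If all blocks were singletons, their weights would be 0 and [pi] would be the bottom. *)
have [B Bpi cardB] : exists2 B, B \in wpart_val pi & #|B.1| != 1%N.
  apply/exists_inP; apply: contraNT pi_neq0; rewrite negb_exists_in => /forall_inP c1.
  have sub (B : wblock 'I_n) : B \in wpart_val pi -> exists x, B = ([set x], ord0).
    move=> Bpi; have [/and3P[_ _]] := blk B Bpi.
    have /negPn/cards1P[x eB] := c1 B Bpi.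
    case: B eB {Bpi} => B v /= ->; rewrite cards1 ltnS leqn0 => /eqP v0 _.
    by exists x; congr pair; apply/val_inj.
  apply/eqP/val_inj/val_inj/eqP; rewrite eqEsubset; apply/andP; split.
    by apply/subsetP => B /sub[x ->]; apply: imset_f.
  apply/subsetP => _ /imsetP[x _ ->].
  have [|B Bpi xB] := cov x; first by rewrite inE.
  by have [y eB] := sub B Bpi; move: Bpi xB; rewrite eB => Bpi /set1P ->.
rewrite (bigD1 B) //=; have [/bond_block_seg[a [b [le_abn eS eB]]] _] := blk B Bpi.
rewrite eS sum_bonds_on_weight_ok; last by lia.
by rewrite eB (negPf cardB) mul0r.
Qed.

End Path.

(** * Narayana polynomials and Catalan numbers *)

Lemma narpow_coef1 n j : (0 < n)%N ->
  narpow_coef n 1 j = n%:R^-1 * 'C(n, j)%:R * 'C(n, j.+1)%:R.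
Proof. by case: n => // n _; rewrite /narpow_coef addn1 div1r. Qed.

(** At a maximal element the product has one factor, whose sign (-1)^(n+1) cancels the prefactor. *)
Lemma map_mobius_poly_path n : (0 < n)%N ->
  (-1) ^+ (n - 1)%N *: map_poly (intr : int -> rat)
                         (mobius_poly (path_graph_connected n))
    = narayana_poly n.
Proof.
move=> n_gt0; rewrite /mobius_poly rmorph_sum /= scaler_sumr.
transitivity (\poly_(j < #|'I_n|) narpow_coef n 1 j).
  rewrite poly_def; apply: eq_bigr => j _.
  rewrite map_polyZ map_polyXn /= mobius_path big_set1 scalerA /nweight cardsT /=.
  move: (nat_of_ord j) => k; rewrite coef_snarpow card_ord mulrA -exprD.
  rewrite (_ : (n - 1 + (n + 1) = n.*2)%N); last lia.
  by rewrite -signr_odd odd_double mul1r.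
rewrite card_ord poly_def; apply: eq_bigr => j _.
by rewrite narpow_coef1.
Qed.

(** Vandermonde's convolution, after reflecting the second binomial. *)
Lemma narayana1 n : (0 < n)%N -> (narayana_poly n).[1] = catalan n.
Proof.
case: n => // n _; rewrite /narayana_poly horner_sum.
under eq_bigr do rewrite hornerZ hornerXn expr1n mulr1 -mulrA -natrM.
rewrite -mulr_sumr -natr_sum /catalan.
have -> : (\sum_(j < n.+1) 'C(n.+1, j) * 'C(n.+1, j.+1) = 'C(2 * n.+1, n))%N.
  rewrite mul2n -addnn -binomial.Vandermonde; apply: eq_bigr => j _.
  by rewrite -(bin_sub (ltn_ord j)) subSS.
(* With n + 1 as the index: (n + 1) C(2n + 2, n + 1) = (n + 2) C(2n + 2, n) trades the off-centre
   binomial for the central one. *)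
have := mul_bin_left (2 * n.+1) n => /(congr1 (fun k => k%:R : rat)).
rewrite !natrM (_ : (2 * n.+1 - n = n.+2)%N); last lia.
by move=> e; apply: (@mulfI _ n.+1%:R); rewrite ?pnatr_eq0 // mulVKf ?pnatr_eq0 //
  mulrCA e mulKf ?pnatr_eq0.
Qed.

Theorem theorem3p2 (n : nat) (hn : (1 <= n)%N) :
  (-1) ^+ (n - 1)%N *: map_poly (intr : int -> rat)
                         (mobius_poly (path_graph_connected n))
    = narayana_poly n
  /\ ((-1) ^+ (n - 1)%N * (mobius_poly (path_graph_connected n)).[1])%:~R
    = catalan n.
Proof.
split; first exact: map_mobius_poly_path.
rewrite -narayana1 // -map_mobius_poly_path // hornerZ rmorphM rmorph_sign /=.
by rewrite -horner_map /= rmorph1.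
Qed.
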